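(* For all integers $n\ge0$ and $m$, there is a bijection between the set of Motzkin paths (respectively Grand Motzkin paths) from $(0,0)$ to $(2n,m)$ that avoid flat steps at even indices, and the set of vertically constrained $S_{DW}$ paths from $(0,0)$ to $(n,m)$ whose first step (if any) is in $\{(1,1),(1,-1)\}$ and all of whose vertices have $y\ge0$ (respectively, with no height restriction).
   Context: A lattice path is a finite sequence of steps (vectors in $\mathbb{Z}^2$) starting at $(0,0)$; its vertices are the partial sums. A Grand Motzkin path is a lattice path with steps in $\{(1,0),(1,1),(1,-1)\}$; a Motzkin path is a Grand Motzkin path all of whose vertices have $y\ge0$. The step $(1,0)$ is called flat. The steps of a path of $L$ steps are indexed $e_0,e_1,\dots,e_{L-1}$, and ''avoids flat steps at even indices'' means $e_i\neq(1,0)$ for every even $i$. Let $S_{DW}=\{(1,1),(1,-1),(0,1),(0,-1)\}$; $(0,\pm1)$ are vertical steps. A vertically constrained $S_{DW}$ path is a lattice path with steps in $S_{DW}$ with no two consecutive vertical steps. *)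

(* Defs.v *)
From HB Require Import structures.
From mathcomp Require Import all_boot all_order all_algebra.

Set Implicit Arguments.
Unset Strict Implicit.
Unset Printing Implicit Defensive.

Import Order.TTheory GRing.Theory Num.Theory.
Local Open Scope ring_scope.

Definition step : Type := (int * int)%type.

(* A lattice path is its sequence of steps e_0, e_1, ...; it starts at 0. *)
Definition lattice_path : Type := seq step.

Definition vertices (p : lattice_path) : seq (int * int) :=
  0 :: scanl +%R 0 p.

Definition endpoint (p : lattice_path) : int * int := last 0 (vertices p).

Definition steps_in (S : seq step) (p : lattice_path) : bool :=
  all (fun e => e \in S) p.

Definition nonneg_height (p : lattice_path) : bool :=
  all (fun v : int * int => 0 <= v.2) (vertices p).

Definition flat : step := (1, 0).
Definition motzkin_steps : seq step := [:: (1, 0); (1, 1); (1, -1)].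

Definition grand_motzkin (p : lattice_path) : bool := steps_in motzkin_steps p.

Definition motzkin (p : lattice_path) : bool :=
  grand_motzkin p && nonneg_height p.

Definition avoids_flat_at_even (p : lattice_path) : bool :=
  all (fun i => ~~ odd i ==> (nth 0 p i != flat)) (iota 0 (size p)).

Definition diagonal_steps : seq step := [:: (1, 1); (1, -1)].
Definition vertical_steps : seq step := [:: (0, 1); (0, -1)].
Definition S_DW : seq step := [:: (1, 1); (1, -1); (0, 1); (0, -1)].

Definition vertically_constrained (p : lattice_path) : bool :=
  steps_in S_DW p &&
  sorted (fun e e' => ~~ ((e \in vertical_steps) && (e' \in vertical_steps))) p.

Definition first_step_diagonal (p : lattice_path) : bool :=
  if p is e :: _ then e \in diagonal_steps else true.

(* Main.v *)
Require Import Defs.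
From HB Require Import structures.
From mathcomp Require Import all_boot all_order all_algebra.
From mathcomp Require Import zify.

Import Order.TTheory GRing.Theory Num.Theory.
Local Open Scope ring_scope.

(** Cut a path of length [2n] into [n] blocks [e_(2i) e_(2i+1)]. The first step of
    a block is diagonal and is kept. The second one is deleted if it is flat, and
    otherwise replaced by the vertical step of the same height. In the resulting
    path every vertical step follows a diagonal one, so the blocks can be read off
    again. A deleted step repeats a height, so the set of visited heights is
    unchanged, while each block now advances by one instead of two. *)

(** Both predicates are boolean, so elements of the subtypes are equal once their values are. *)
Lemma exists_bijective_sig (T U : Type) (P : pred T) (Q : pred U)
    (f : T -> U) (g : U -> T) :
    (forall x, P x -> Q (f x) /\ g (f x) = x) ->
    (forall y, Q y -> P (g y) /\ f (g y) = y) ->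
  exists h : {x | P x} -> {y | Q y}, bijective h.
Proof.
move=> fP gQ.
exists (fun x => exist _ (f (val x)) (fP _ (valP x)).1).
exists (fun y => exist _ (g (val y)) (gQ _ (valP y)).1) => x.
- by apply: val_inj; exact: (fP _ (valP x)).2.
- by apply: val_inj; exact: (gQ _ (valP x)).2.
Qed.

Lemma seq_two_step_ind (T : Type) (P : seq T -> Prop) :
    P [::] -> (forall a, P [:: a]) -> (forall a b s, P s -> P [:: a, b & s]) ->
  forall s, P s.
Proof.
(* Carrying all one-step extensions along reduces the claim to ordinary induction. *)
move=> P0 P1 P2 s; suff [] : P s /\ (forall a, P (a :: s)) by [].
by elim: s => [|b s [Ps Pbs]]; split=> // a; apply: P2.
Qed.

Lemma last_scanl_add (V : zmodType) (v : V) (s : seq V) :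
  last v (scanl +%R v s) = v + \sum_(e <- s) e.
Proof.
elim: s v => [|e s IHs] v /=; first by rewrite big_nil addr0.
by rewrite IHs big_cons addrA.
Qed.

Lemma endpoint_sum (p : lattice_path) : endpoint p = \sum_(e <- p) e.
Proof. by rewrite /endpoint /= last_scanl_add add0r. Qed.

Lemma endpoint_cons (e : step) (p : lattice_path) :
  endpoint (e :: p) = e + endpoint p.
Proof. by rewrite !endpoint_sum big_cons. Qed.

Lemma endpoint_grand_motzkin (p : lattice_path) :
  grand_motzkin p -> (endpoint p).1 = (size p)%:Z.
Proof.
elim: p => [|e p IHp] //= /andP[ein /IHp]; rewrite endpoint_cons /= => ->.
by move: ein; rewrite !inE => /or3P[] /eqP->; rewrite [RHS]intS.
Qed.

(** Removing two steps shifts the remaining indices by two and so keeps their parity. *)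
Lemma avoids_flat_at_even_cons2 (a b : step) (p : lattice_path) :
  avoids_flat_at_even [:: a, b & p] = (a != flat) && avoids_flat_at_even p.
Proof.
rewrite /avoids_flat_at_even /= (iotaDl 2 0) all_map; congr (_ && _).
by apply: eq_all => i /=; rewrite negbK.
Qed.

Fixpoint even_flat_free (p : lattice_path) : bool :=
  match p with
  | [::] => true
  | [:: _] => false
  | [:: a, b & p'] =>
      [&& a \in diagonal_steps, b \in motzkin_steps & even_flat_free p']
  end.

Lemma even_flat_freeE (p : lattice_path) :
  even_flat_free p = [&& grand_motzkin p, avoids_flat_at_even p & ~~ odd (size p)].
Proof.
elim/seq_two_step_ind: p => [//|a|a b p IHp]; first by rewrite /= !andbF.
rewrite avoids_flat_at_even_cons2 /= IHp /grand_motzkin /= negbK.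
have -> : (a \in diagonal_steps) = (a \in motzkin_steps) && (a != flat).
  by rewrite !inE; have [->|] := eqVneq a flat; rewrite ?andbT ?andbF.
by do !case: (_ \in _) => //=; rewrite ?andbF //; case: (a != flat); rewrite ?andbF.
Qed.

(** Every Motzkin step advances by one, so the abscissa [2 * n] is the length of the path; this
    supplies the even length built into [even_flat_free]. *)
Lemma grand_motzkin_evenE (n : nat) (m : int) (p : lattice_path) :
  [&& grand_motzkin p, endpoint p == ((2 * n)%N%:Z, m) & avoids_flat_at_even p] =
  even_flat_free p && (endpoint p == ((2 * n)%N%:Z, m)).
Proof.
rewrite even_flat_freeE.
have [gp|] //= := boolP (grand_motzkin p).
have [ep|] /= := eqVneq; last by rewrite andbF.
have := endpoint_grand_motzkin p gp; rewrite ep => -[<-].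
by rewrite mul2n odd_double !andbT.
Qed.

Definition constrained_diagonal (q : lattice_path) : bool :=
  vertically_constrained q && first_step_diagonal q.

Lemma mem_S_DW (e : step) :
  (e \in S_DW) = (e \in diagonal_steps) || (e \in vertical_steps).
Proof. by rewrite !inE !orbA. Qed.

Lemma diagonal_not_vertical (e : step) :
  e \in diagonal_steps -> (e \in vertical_steps) = false.
Proof. by rewrite !inE => /orP[] /eqP->. Qed.

Lemma vertically_constrained_diagonal (a : step) (q : lattice_path) :
  a \in diagonal_steps ->
  vertically_constrained (a :: q) = vertically_constrained q.
Proof.
move=> da; rewrite /vertically_constrained /= mem_S_DW da /=; congr (_ && _).
by case: q => //= b q; rewrite (diagonal_not_vertical a).
Qed.

(** Within [S_DW], not following a vertical step by another one means that the rest is empty or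
    opens diagonally. *)
Lemma vertically_constrained_vertical (v : step) (q : lattice_path) :
  v \in vertical_steps ->
  vertically_constrained (v :: q) = constrained_diagonal q.
Proof.
move=> vv; rewrite /constrained_diagonal /vertically_constrained /=.
rewrite mem_S_DW vv orbT /=; case: q => //= b q; rewrite vv /= mem_S_DW.
have [db|_] /= := boolP (b \in diagonal_steps).
  by rewrite (diagonal_not_vertical b) //= andbT.
by case: (b \in _); rewrite ?andbF.
Qed.

Fixpoint contract (p : lattice_path) : lattice_path :=
  match p with
  | [:: a, b & p'] =>
      a :: (if b == flat then contract p' else (0, b.2) :: contract p')
  | _ => p
  end.

(* A vertical step opening the argument counts as the second half of a block. *)
Fixpoint expand (q : lattice_path) : lattice_path :=
  match q with
  | [::] => [::]
  | e :: q' =>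
      if e \in vertical_steps then (1, e.2) :: expand q'
      else e :: (if first_step_diagonal q' then flat :: expand q' else expand q')
  end.

Lemma contract_constrained (p : lattice_path) :
  even_flat_free p -> constrained_diagonal (contract p).
Proof.
elim/seq_two_step_ind: p => [//|//|a b p IHp] /and3P[da bm /IHp cp].
rewrite /constrained_diagonal [contract _]/= vertically_constrained_diagonal //=.
rewrite da andbT; have [_|nb] := eqVneq b flat; first by case/andP: cp.
rewrite vertically_constrained_vertical //.
by move: bm nb; rewrite !inE => /or3P[] /eqP->.
Qed.

Lemma contractK (p : lattice_path) : even_flat_free p -> expand (contract p) = p.
Proof.
elim/seq_two_step_ind: p => [//|//|a b p IHp] /and3P[da bm pM].
(* The contracted rest does not open vertically, which is how [expand] knows to reinsert a deleted
   flat step after [a]. *)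
have /andP[_ cp] := contract_constrained _ pM.
rewrite /= (diagonal_not_vertical a) //; have [->|nb] := eqVneq b flat.
  by rewrite cp IHp.
by move: bm nb; rewrite !inE => /or3P[] /eqP-> //= _; rewrite IHp.
Qed.

(* For the induction, a path opening with a vertical step is completed by an
   arbitrary diagonal step [a]. *)
Lemma expand_completed (a : step) (q : lattice_path) :
    a \in diagonal_steps -> vertically_constrained q ->
  let p := if first_step_diagonal q then expand q else a :: expand q in
  even_flat_free p /\ contract p = if first_step_diagonal q then q else a :: q.
Proof.
elim: q a => [//|e q IHq] a da cq.
have : e \in S_DW by case/andP: cq => /andP[].
rewrite mem_S_DW [first_step_diagonal _]/=.
have [de _|_ /orP[//|ve]] := boolP (e \in diagonal_steps).
  rewrite vertically_constrained_diagonal // in cq.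
  (* Here [e] itself is the completing step for a rest that opens vertically. *)
  rewrite /= (diagonal_not_vertical e) //; have := IHq e de cq.
  case: (first_step_diagonal q) => //= -[-> ->].
  by rewrite de.
rewrite vertically_constrained_vertical // in cq; case/andP: cq => cq dq.
have -> : expand (e :: q) = (1, e.2) :: expand q by rewrite /= ifT.
have := IHq a da cq; rewrite dq /= da => -[-> ->].
by move: ve; rewrite !inE => /orP[] /eqP->.
Qed.

Lemma expandK (q : lattice_path) :
  constrained_diagonal q -> even_flat_free (expand q) /\ contract (expand q) = q.
Proof.
case/andP=> cq dq.
(* Any diagonal step could replace [(1, 1)]: as [q] does not open vertically, nothing is
   prepended. *)
by have := expand_completed (1, 1) q isT cq; rewrite dq.
Qed.

(** A block advances by two and its contraction by one, with the same rise. *)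
Lemma endpoint_contract (p : lattice_path) : even_flat_free p ->
  endpoint p = ((endpoint (contract p)).1 *+ 2, (endpoint (contract p)).2).
Proof.
elim/seq_two_step_ind: p => [//|//|a b p IHp] /and3P[da bm /IHp].
rewrite [contract _]/= !endpoint_cons => ->.
have [b1 a1] : (b.1 = 1) * (a.1 = 1).
  by move: da bm; rewrite !inE => /orP[] /eqP-> /or3P[] /eqP->.
have [->|_] := eqVneq b flat; rewrite -/contract ?endpoint_cons;
  case: (endpoint (contract p)) => x y; apply: injective_projections => //=;
  rewrite ?a1 ?b1 ?add0r //; lia.
Qed.

Lemma endpoint_contract_eq (n : nat) (m : int) (p : lattice_path) :
    even_flat_free p ->
  (endpoint p == ((2 * n)%N%:Z, m)) = (endpoint (contract p) == (n%:Z, m)).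
Proof.
move/endpoint_contract->; case: (endpoint _) => x y; rewrite !xpair_eqE /=.
by congr (_ && _); lia.
Qed.

(** The abscissae of the two paths drift apart, so the induction keeps two starting points that
    share only their height. A deleted flat step just tests one height twice. *)
Lemma nonneg_scanl_contract (v w : int * int) (p : lattice_path) :
    even_flat_free p -> v.2 = w.2 -> 0 <= v.2 ->
  all (fun u : int * int => 0 <= u.2) (scanl +%R v p) =
  all (fun u : int * int => 0 <= u.2) (scanl +%R w (contract p)).
Proof.
elim/seq_two_step_ind: p v w => [//|//|a b p IHp] v w /and3P[_ _ pM] vw v0 /=.
rewrite vw; have [h0|] //= := boolP (0 <= w.2 + a.2).
have [->|_] /= := eqVneq b flat.
  by rewrite addr0 h0; apply: IHp; rewrite //= vw addr0.
have [h1|] //= := boolP (0 <= w.2 + a.2 + b.2).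
by apply: IHp; rewrite //= vw.
Qed.

Lemma nonneg_height_contract (p : lattice_path) :
  even_flat_free p -> nonneg_height p = nonneg_height (contract p).
Proof. by move=> pM; rewrite /nonneg_height /= (nonneg_scanl_contract 0 0). Qed.

(** The two halves of the theorem differ only in the side conditions [C] and [D], which [contract]
    has to match. *)
Lemma exists_bijective_contract (P Q C D : pred lattice_path) :
    (forall p, P p = even_flat_free p && C p) ->
    (forall q, Q q = constrained_diagonal q && D q) ->
    (forall p, even_flat_free p -> C p = D (contract p)) ->
  exists f : {p | P p} -> {q | Q q}, bijective f.
Proof.
move=> PE QE CD; apply: (exists_bijective_sig _ _ _ _ contract expand) => [p|q].
  rewrite PE QE => /andP[pM Cp].
  by rewrite contract_constrained // -CD // contractK.
rewrite PE QE => /andP[/expandK[qM cq] Dq].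
by rewrite qM CD // cq.
Qed.

Theorem theorem14 (n : nat) (m : int) :
  (exists f :
     {p : lattice_path |
        [&& motzkin p, endpoint p == ((2 * n)%N%:Z, m) & avoids_flat_at_even p]} ->
     {q : lattice_path |
        [&& vertically_constrained q, endpoint q == (n%:Z, m),
            first_step_diagonal q & nonneg_height q]},
     bijective f) /\
  (exists f :
     {p : lattice_path |
        [&& grand_motzkin p, endpoint p == ((2 * n)%N%:Z, m) & avoids_flat_at_even p]} ->
     {q : lattice_path |
        [&& vertically_constrained q, endpoint q == (n%:Z, m)
          & first_step_diagonal q]},
     bijective f).
Proof.
split.
- apply: (exists_bijective_contract _ _
    (fun p => (endpoint p == ((2 * n)%N%:Z, m)) && nonneg_height p)
    (fun q => (endpoint q == (n%:Z, m)) && nonneg_height q)) => [p|q|p pM] /=.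
  + by rewrite [RHS]andbA -grand_motzkin_evenE /motzkin -!andbA; do !bool_congr.
  + by rewrite /constrained_diagonal -!andbA; do !bool_congr.
  + by rewrite (endpoint_contract_eq n) // nonneg_height_contract.
- apply: (exists_bijective_contract _ _
    (fun p => endpoint p == ((2 * n)%N%:Z, m))
    (fun q => endpoint q == (n%:Z, m))) => [p|q|p pM] /=.
  + exact: grand_motzkin_evenE.
  + by rewrite /constrained_diagonal -!andbA; do !bool_congr.
  + exact: endpoint_contract_eq.
Qed.
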